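(* Let $C=C_1\cup\dots\cup C_n$ be a bouquet of unit circles through a point $O\in\mathbb{R}^2$, and for every $i$ let $O_i$ be the centre of $C_i$. Suppose that $O,O_1,\dots,O_n\in\mathbb{Q}^2$ and that $O$ is an extreme point of $\{O,O_1,\dots,O_n\}$, i.e. $O\notin\operatorname{conv}\{O_1,\dots,O_n\}$. Then for every $k\in\mathbb{N}$, every proper $k$-colouring of $\mathbb{R}^2$ contains a smiling congruent copy of $C$.
   Context: A bouquet through $O$ is a union $C=C_1\cup\dots\cup C_n$ of unit circles (radius $1$) in the plane all passing through the common point $O$. A colouring $\varphi:\mathbb{R}^2\to[k]$ is a proper $k$-colouring if $\|p-q\|=1$ implies $\varphi(p)\neq\varphi(q)$. A congruent copy of $C$ is its image $g(C)=g(C_1)\cup\dots\cup g(C_n)$ under an isometry $g$ of the plane; it is a bouquet through $g(O)$. For a given colouring, a bouquet $C_1\cup\dots\cup C_n$ through $O$ is smiling if there is a colour $c$ such that every circle $C_i$ contains a point of colour $c$ but $O$ does not have colour $c$. *)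

(* Defs.v *)
From mathcomp Require Import all_boot all_order all_algebra.
From mathcomp Require Import boolp classical_sets reals convex.

Set Implicit Arguments.
Unset Strict Implicit.
Unset Printing Implicit Defensive.

Import Order.TTheory GRing.Theory Num.Theory.
Local Open Scope classical_set_scope.
Local Open Scope ring_scope.

Section Plane.
Context {R : realType}.

Local Notation plane := 'rV[R]_2.

(* The library norm on row vectors is the sup norm, hence this definition. *)
Definition eucl_dist (p q : plane) : R :=
  Num.sqrt (\sum_(j < 2) (p ord0 j - q ord0 j) ^+ 2).

Definition plane_isometry (g : plane -> plane) : Prop :=
  forall p q, eucl_dist (g p) (g q) = eucl_dist p q.

Definition rational_point (p : plane) : Prop :=
  forall j : 'I_2, rational (p ord0 j).

Definition convex_hull (A : set plane) : set plane :=
  smallest (@convex_set R plane) A.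

Definition unit_circle (c : plane) : set plane := [set p | eucl_dist c p = 1].

(* A bouquet is kept as the family of its circles, not only as their union,
   since smiling refers to the individual circles. *)
Definition bouquet (n : nat) (O : plane) (C : 'I_n -> set plane) : Prop :=
  forall i, (exists c, C i = unit_circle c) /\ C i O.

Definition proper_colouring (k : nat) (phi : plane -> 'I_k) : Prop :=
  forall p q, eucl_dist p q = 1 -> phi p <> phi q.

Definition smiling (k n : nat) (phi : plane -> 'I_k) (O : plane)
    (C : 'I_n -> set plane) : Prop :=
  exists c : 'I_k, (forall i, exists2 p, C i p & phi p = c) /\ phi O <> c.

Definition image_family (n : nat) (g : plane -> plane)
    (C : 'I_n -> set plane) : 'I_n -> set plane :=
  fun i => g @` C i.

End Plane.

(* Main.v *)
(* Let u_i = O_i - O. If some point p and scale 0 < t <= 2 have all p + t u_i of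
   one colour (after a rotation) but not p, then a congruent copy of the bouquet
   at p smiles, since turning the u_i suitably brings them to distance 1 from
   the t u_i. Suppose this never happens. As O is extreme, some v has positive
   inner product with all u_i, so by density of rational rotations every long
   integer vector q gets strictly shorter when any D z u_i is added, for some
   rational rotation z and a fixed D making all D z u_i integral. Gallai's
   theorem gives a monochromatic homothetic copy, with ratio 1 / (m D), of the
   integer points of a large disc; by induction on the length of q its colour
   spreads to the whole similar copy of Z^2, which contains two points at
   distance 1. *)
Require Import Defs.
From mathcomp Require Import all_boot all_order all_algebra.
From mathcomp Require Import boolp classical_sets reals convex.
From mathcomp Require Import interval_inference.
From mathcomp Require Import ring lra zify.
Set Implicit Arguments.
Unset Strict Implicit.
Import Order.TTheory GRing.Theory Num.Theory.
Local Open Scope classical_set_scope.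
Local Open Scope ring_scope.

(** * Gallai's theorem by colour focusing *)

(* The colouring of [M] by the pattern seen through the window [W] turns the
   statement for [v0 :: V] into colour focusing: if [p + s V] looks constant
   through [W], a configuration focused at [f] inside [W] reappears at [p + f],
   with all its steps increased by [s], and with the extra step [s]. *)
Lemma colour_focusing (M : zmodType) (T : finType) (v0 : M) (V : seq M)
    (hV : forall T' : finType, exists2 L : seq (M * nat),
       {in L, forall pt, (0 < pt.2)%N} &
       forall phi : M -> T', exists2 pt, pt \in L &
         {in v0 :: V, forall v,
            phi (pt.1 + v *+ pt.2) = phi (pt.1 + v0 *+ pt.2)}) (j : nat) :
  exists2 L : seq (M * seq nat),
    {in L, forall ft, {in ft.2, forall t, 0 < t}%N} &
    forall phi : M -> T, exists ft, [/\ ft \in L,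
      {in ft.2, forall t, {in v0 :: V, forall v,
         phi (ft.1 + v *+ t) = phi (ft.1 + v0 *+ t)}} &
      phi ft.1 \in [seq phi (ft.1 + v0 *+ t) | t <- ft.2] \/
      (size ft.2 = j /\
       uniq (phi ft.1 :: [seq phi (ft.1 + v0 *+ t) | t <- ft.2]))].
Proof.
elim: j => [|j [L Lpos hL]].
  exists [:: (0, [::])] => [_ /[!inE]/eqP-> t|phi]; first by rewrite in_nil.
  by exists (0, [::]); split; [rewrite inE|move=> t|right].
(* The extra step [0] keeps the focus itself visible in the window. *)
pose W := [seq x.1 + x.2.1 *+ x.2.2
          | x <- [seq (ft.1, vt)
                 | ft <- L, vt <- [seq (v, t) | v <- v0 :: V, t <- 0%N :: ft.2]]].
have inW ft v t : ft \in L -> v \in v0 :: V -> t \in 0%N :: ft.2 ->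
    ft.1 + v *+ t \in W.
  move=> ftL vV tft; apply/mapP; exists (ft.1, (v, t)) => //.
  apply/allpairsPdep; exists ft, (v, t); split=> //.
  by apply/allpairsPdep; exists v, t.
have [P Ppos hP] := hV ((size W).-tuple T).
(* [K1] translates a focus that already shares the colour of one of its configurations; [K2] moves
   the focus to [p + f] and gains a step. *)
pose K1 := [seq (p.1 + v0 *+ p.2 + ft.1, ft.2) | p <- P, ft <- L].
pose K2 := [seq (p.1 + ft.1, p.2 :: [seq (p.2 + t)%N | t <- ft.2])
           | p <- P, ft <- L].
exists (K1 ++ K2).
  move=> ft; rewrite mem_cat => /orP[] /allpairsPdep[p [gs [pP gsL ->]]] /= t.
    exact: (Lpos _ gsL).
  rewrite inE => /orP[/eqP->|/mapP[s sgs ->]]; first exact: Ppos.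
  by rewrite addn_gt0 (Ppos _ pP).
move=> phi.
have [[p s] pP /= hp] :=
  hP (fun x => map_tuple (fun w => phi (x + w)) (in_tuple W)).
have hpW v w : v \in v0 :: V -> w \in W ->
    phi (p + v *+ s + w) = phi (p + v0 *+ s + w).
  by move=> vV wW; have /(congr1 val)/= /eq_in_map := hp v vV; apply.
have [[f ts] [ftL hf halt]] := hL (fun x => phi (p + v0 *+ s + x)).
rewrite /= in hf halt.
case: halt => [mono|[sz un]].
  exists (p + v0 *+ s + f, ts); split.
  - by rewrite mem_cat; apply/orP; left; apply/allpairsPdep; exists (p, s), (f, ts).
  - by move=> t tts v vV /=; rewrite -!addrA !(addrA p) hf// -!addrA.
  - left; move: mono => /=; congr (_ \in _).
    by apply: eq_map => t /=; rewrite !addrA.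
have fW : f \in W.
  have := inW (f, ts) v0 0%N ftL (mem_head _ _) (mem_head _ _).
  by rewrite /= mulr0n addr0.
have ftW t v : t \in ts -> v \in v0 :: V -> f + v *+ t \in W.
  by move=> tts vV; apply: (inW (f, ts)) => //; rewrite inE tts orbT.
have shift t v : t \in ts -> v \in v0 :: V ->
    phi (p + f + v *+ (s + t)) = phi (p + v0 *+ s + (f + v0 *+ t)).
  move=> tts vV; rewrite -[RHS](hf t tts v vV) -(hpW v) ?ftW//.
  by rewrite mulrnDr addrACA -!addrA.
have shift0 v : v \in v0 :: V ->
    phi (p + f + v *+ s) = phi (p + v0 *+ s + f).
  by move=> vV; rewrite addrAC hpW.
have E : [seq phi (p + f + v0 *+ t) | t <- s :: [seq (s + t)%N | t <- ts]]
    = phi (p + v0 *+ s + f) :: [seq phi (p + v0 *+ s + (f + v0 *+ t)) | t <- ts].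
  rewrite /= shift0 ?mem_head//; congr (_ :: _); rewrite -map_comp.
  by apply/eq_in_map => t tts /=; rewrite shift ?mem_head.
exists (p + f, s :: [seq (s + t)%N | t <- ts]); split.
- by rewrite mem_cat; apply/orP; right; apply/allpairsPdep; exists (p, s), (f, ts).
- move=> t; rewrite inE => /orP[/eqP->|/mapP[r rts ->]] v vV.
    by rewrite /= !shift0 ?mem_head.
  by rewrite /= !shift ?mem_head.
- rewrite [(_, _).1]/= [(_, _).2]/= E.
  case: (boolP (phi (p + f) \in _)) => [|nin]; [by left|right].
  by rewrite /= size_map sz; split=> //; apply/andP; split.
Qed.

(** This adds the vertex [0]: [#|T|] configurations of distinct colours, all different from that of
    their focus, would take [#|T| + 1] colours, so the focus agrees with one of them. *)
Lemma gallai_cons0 (M : zmodType) (v0 : M) (V : seq M)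
    (hV : forall T : finType, exists2 L : seq (M * nat),
       {in L, forall pt, (0 < pt.2)%N} &
       forall phi : M -> T, exists2 pt, pt \in L &
         {in v0 :: V, forall v,
            phi (pt.1 + v *+ pt.2) = phi (pt.1 + v0 *+ pt.2)}) (T : finType) :
  exists2 L : seq (M * nat),
    {in L, forall pt, (0 < pt.2)%N} &
    forall phi : M -> T, exists2 pt, pt \in L &
      {in v0 :: V, forall v, phi (pt.1 + v *+ pt.2) = phi pt.1}.
Proof.
have [L Lpos hL] := @colour_focusing _ T _ _ hV #|T|.
exists [seq (ft.1, t) | ft <- L, t <- ft.2].
  by move=> pt /allpairsPdep[ft [t [ftL tft ->]]]; apply: Lpos tft.
move=> phi; have [[f ts] [ftL hf [/mapP[t tts e]|[sz un]]]] := hL phi.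
  exists (f, t); first by apply/allpairsPdep; exists (f, ts), t.
  by move=> v vV /=; rewrite (hf t tts v vV) -e.
have := max_card (mem (phi f :: [seq phi (f + v0 *+ t) | t <- ts])).
by rewrite (card_uniqP un) /= size_map sz ltnn.
Qed.

(* The steps and positions are confined to a finite list in order that the
   statement can be applied to a colouring by patterns and transported back. *)
Lemma gallai_list (M : zmodType) (V : seq M) (v0 : M) (T : finType) :
  exists2 L : seq (M * nat),
    {in L, forall pt, (0 < pt.2)%N} &
    forall phi : M -> T, exists2 pt, pt \in L &
      {in v0 :: V, forall v,
         phi (pt.1 + v *+ pt.2) = phi (pt.1 + v0 *+ pt.2)}.
Proof.
elim: V v0 T => [|v1 V IH] v0 T.
  exists [:: (0, 1%N)] => [pt /[!inE]/eqP->//|phi].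
  by exists (0, 1%N) => [|v /[!inE]/eqP->//]; rewrite inE.
(* Subtracting [v0] makes it the vertex [0] that [gallai_cons0] adds; shifting the position by
   [- v0 *+ pt.2] undoes this. *)
pose sub x := x - v0.
have hsub (T' : finType) : exists2 L : seq (M * nat),
    {in L, forall pt, (0 < pt.2)%N} &
    forall phi : M -> T', exists2 pt, pt \in L &
      {in sub v1 :: map sub V, forall v,
         phi (pt.1 + v *+ pt.2) = phi (pt.1 + sub v1 *+ pt.2)}.
  have [L Lpos hL] := IH v1 T'.
  exists [seq (pt.1 + v0 *+ pt.2, pt.2) | pt <- L].
    by move=> _ /mapP[pt ptL ->]; exact: (Lpos _ ptL).
  move=> phi; have [pt ptL hpt] := hL phi.
  exists (pt.1 + v0 *+ pt.2, pt.2); first by apply/mapP; exists pt.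
  have E v : pt.1 + v0 *+ pt.2 + sub v *+ pt.2 = pt.1 + v *+ pt.2.
    by rewrite -addrA -mulrnDl /sub [v0 + _]addrC subrK.
  move=> _ /(mapP (s := v1 :: V))[v vV ->] /=; rewrite !E; exact: hpt.
have [L Lpos hL] := @gallai_cons0 M _ _ hsub T.
exists [seq (pt.1 - v0 *+ pt.2, pt.2) | pt <- L].
  by move=> _ /mapP[pt ptL ->]; exact: (Lpos _ ptL).
move=> phi; have [pt ptL hpt] := hL phi.
exists (pt.1 - v0 *+ pt.2, pt.2); first by apply/mapP; exists pt.
move=> v; rewrite inE => /orP[/eqP->//|vV] /=.
rewrite subrK -(hpt (sub v)); last exact: (map_f sub (s := v1 :: V)).
by rewrite /sub mulrnBl addrA addrAC.
Qed.

(** The bound [N] makes [N!] a multiple of every possible ratio [t]. *)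
Lemma gallai (M : zmodType) (V : seq M) (T : finType) :
  exists N : nat, forall phi : M -> T,
    exists p t, [/\ (0 < t)%N, (t <= N)%N &
      {in V &, forall v w, phi (p + v *+ t) = phi (p + w *+ t)}].
Proof.
have [L Lpos hL] := gallai_list V 0 T.
exists (\max_(pt <- L) pt.2) => phi.
have [[p t] ptL h] := hL phi; exists p, t; split.
- exact: (Lpos _ ptL).
- exact: (@leq_bigmax_seq _ _ xpredT (fun pt : M * nat => pt.2) _ ptL).
- by move=> v w vV wV; rewrite (h v) ?(h w)// inE ?vV ?wV orbT.
Qed.

(** * Unit vectors: a separating normal or a vanishing positive combination *)

(** Here [c] is the inner product of unit vectors [a], [b], and [x], [y] are the coordinates of
    [- u] for a unit vector [u]. If [y < 0], then [xy < 0] and [0 < x - y < 1], against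
    [1 = (x - y)^2 + 2xy(1 + c)]. *)
Lemma nonneg_coefficient (R : realFieldType) (c x y : R) :
  -1 < c -> c < 1 -> x ^+ 2 + y ^+ 2 + 2 * x * y * c = 1 ->
  c <= - (x + y * c) -> c <= - (x * c + y) -> 0 <= x + y -> 0 <= y.
Proof.
move=> c1 c2 n1 ha hb hxy; rewrite leNgt; apply/negP => y0.
have x0 : 0 < x by lra.
have c0 : c < 0 by rewrite ltNge; apply/negP => c0; nra.
have y1 : -1 < y by nra.
have xy1 : x - y < 1 by nra.
have : (x - y) ^+ 2 < 1 by nra.
have : 0 <= (x * - y) * (1 + c) by rewrite mulr_ge0 ?mulr_ge0//; lra.
nra.
Qed.

(** Cramer's rule gives [x] and [y]. The inner products of [u] with [a] and [b] add up to
    [- (x + y)(1 + c)], so [x + y >= 0], and [nonneg_coefficient] applies to both coefficients by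
    symmetry. *)
Lemma opposite_combination (R : realFieldType) (a b u : R * R) :
  let dot (p q : R * R) := p.1 * q.1 + p.2 * q.2 in
  dot a a = 1 -> dot b b = 1 -> dot u u = 1 ->
  -1 < dot a b -> dot a b <= dot a u -> dot a b <= dot b u ->
  dot a u + dot b u <= 0 ->
  exists x y, [/\ 0 <= x, 0 <= y, u.1 + x * a.1 + y * b.1 = 0 &
                  u.2 + x * a.2 + y * b.2 = 0].
Proof.
case: a b u => [a1 a2] [b1 b2] [u1 u2] dot; rewrite {}/dot /=.
move=> na nb nu c1 ha hb hv.
pose c := a1 * b1 + a2 * b2; pose d := a1 * b2 - a2 * b1.
have c2 : c < 1.
  rewrite ltNge; apply/negP => c2; rewrite -/c in ha hb; lra.
have dE : d ^+ 2 = 1 - c ^+ 2.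
  have -> : d ^+ 2 = (a1 * a1 + a2 * a2) * (b1 * b1 + b2 * b2) - c ^+ 2.
    by rewrite /d /c; ring.
  by rewrite na nb mulr1.
have d0 : d != 0.
  rewrite -sqrf_eq0 dE.
  have : 0 < (1 - c) * (1 + c) by apply: mulr_gt0; rewrite /c; lra.
  by move=> h; apply: lt0r_neq0; move: h; congr (0 < _); ring.
pose x := - (u1 * b2 - u2 * b1) / d; pose y := - (a1 * u2 - a2 * u1) / d.
have u1E : u1 = - (x * a1 + y * b1) by rewrite /x /y /d; field.
have u2E : u2 = - (x * a2 + y * b2) by rewrite /x /y /d; field.
have auE : a1 * u1 + a2 * u2 = - (x + y * c).
  have -> : x + y * c = x * (a1 * a1 + a2 * a2) + y * c by rewrite na mulr1.
  by rewrite [in LHS]u1E [in LHS]u2E /c; ring.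
have buE : b1 * u1 + b2 * u2 = - (x * c + y).
  have -> : x * c + y = x * c + y * (b1 * b1 + b2 * b2) by rewrite nb mulr1.
  by rewrite [in LHS]u1E [in LHS]u2E /c; ring.
have uuE : x ^+ 2 + y ^+ 2 + 2 * x * y * c = 1.
  have -> : x ^+ 2 + y ^+ 2 + 2 * x * y * c = x ^+ 2 * (a1 * a1 + a2 * a2) +
      y ^+ 2 * (b1 * b1 + b2 * b2) + 2 * x * y * c by rewrite na nb !mulr1.
  by rewrite -[RHS]nu [in RHS]u1E [in RHS]u2E /c; ring.
rewrite auE buE -/c in ha hb hv; rewrite -/c in c1.
have xy0 : 0 <= x + y by nra.
exists x, y; split; last 2 first.
- by rewrite u1E; ring.
- by rewrite u2E; ring.
- apply: (@nonneg_coefficient _ c y x) => //; lra.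
- exact: (@nonneg_coefficient _ c x y).
Qed.

(* The sum of two vectors of the family at maximal angle is the normal. *)
Lemma unit_separation (R : realFieldType) (I : finType) (u : I -> R * R) :
  (forall i, (u i).1 * (u i).1 + (u i).2 * (u i).2 = 1) ->
  (exists v : R * R, forall i, 0 < v.1 * (u i).1 + v.2 * (u i).2) \/
  exists i j k x y, [/\ 0 <= x, 0 <= y,
    (u k).1 + x * (u i).1 + y * (u j).1 = 0 &
    (u k).2 + x * (u i).2 + y * (u j).2 = 0].
Proof.
move=> nu; case: (pickP (@predT I)) => [i0 _|I0]; last first.
  by left; exists (0, 0) => i; have := I0 i.
pose dot (p q : R * R) := p.1 * q.1 + p.2 * q.2.
pose F (ij : I * I) := dot (u ij.1) (u ij.2).
have [[i j] _ hmin] := @arg_minP _ _ _ (i0, i0) xpredT F isT.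
have {}hmin k l : dot (u i) (u j) <= dot (u k) (u l) := hmin (k, l) isT.
have [c1|c1] := leP (dot (u i) (u j)) (-1).
  (* Inner product -1 means [u j = - u i], a vanishing combination by itself. *)
  right; exists i, j, i, 0, 1; have := nu i; have := nu j.
  move: c1; rewrite /dot; case: (u i) (u j) => [a1 a2] [b1 b2] /= c1 nb na.
  have : (a1 + b1) ^+ 2 + (a2 + b2) ^+ 2 = 0.
    apply/le_anti/andP; split; last by rewrite addr_ge0 ?sqr_ge0.
    by nra.
  move/eqP; rewrite paddr_eq0 ?sqr_ge0// !sqrf_eq0 => /andP[/eqP e1 /eqP e2].
  by split=> //; lra.
case: (boolP [exists k, dot (u i) (u k) + dot (u j) (u k) <= 0]).
  move=> /existsP[k hk]; right; exists i, j, k.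
  exact: (opposite_combination (nu i) (nu j) (nu k) c1 (hmin i k) (hmin j k) hk).
move=> /existsPn hpos; left; exists ((u i).1 + (u j).1, (u i).2 + (u j).2) => k.
by have := hpos k; rewrite -ltNge /dot /=; lra.
Qed.

(** * Rational points of the unit circle *)

(** The parameter is the tangent of half the angle; [[-1, 1]] gives the right half circle. *)
Definition circle_param (F : fieldType) (s : F) : F * F :=
  ((1 - s ^+ 2) / (1 + s ^+ 2), 2 * s / (1 + s ^+ 2)).

Lemma circle_param_unit (R : realFieldType) (s : R) :
  (circle_param s).1 ^+ 2 + (circle_param s).2 ^+ 2 = 1.
Proof.
have h : 1 + s ^+ 2 != 0 by apply: lt0r_neq0; have := sqr_ge0 s; lra.
by rewrite /=; field.
Qed.

Lemma circle_param_dist (R : realFieldType) (s t : R) :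
  ((circle_param s).1 - (circle_param t).1) ^+ 2 +
  ((circle_param s).2 - (circle_param t).2) ^+ 2 <= 4 * (s - t) ^+ 2.
Proof.
have hs : 1 <= 1 + s ^+ 2 by have := sqr_ge0 s; lra.
have ht : 1 <= 1 + t ^+ 2 by have := sqr_ge0 t; lra.
have hs0 : 1 + s ^+ 2 != 0 by apply: lt0r_neq0; lra.
have ht0 : 1 + t ^+ 2 != 0 by apply: lt0r_neq0; lra.
have -> : ((circle_param s).1 - (circle_param t).1) ^+ 2 +
    ((circle_param s).2 - (circle_param t).2) ^+ 2 =
    4 * (s - t) ^+ 2 / ((1 + s ^+ 2) * (1 + t ^+ 2)).
  by rewrite /=; field; rewrite hs0 ht0.
rewrite ler_pdivrMr; last by rewrite mulr_gt0//; lra.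
by rewrite ler_peMr ?mulr_ege1// mulr_ge0// sqr_ge0.
Qed.

Lemma circle_param_half (R : realFieldType) (x y : R) :
  x ^+ 2 + y ^+ 2 = 1 -> 0 <= x -> (x, y) = circle_param (y / (1 + x)).
Proof.
move=> h x0; have x1 : 1 + x != 0 by apply: lt0r_neq0; lra.
have yE : y ^+ 2 = 1 - x ^+ 2 by lra.
have dE : 1 + (y / (1 + x)) ^+ 2 = 2 / (1 + x).
  by rewrite expr_div_n yE; field.
rewrite /circle_param dE expr_div_n yE; congr (_, _); field.
- by [].
- by rewrite x1.
Qed.

Lemma rational_circle_param (R : realType) (q : rat) :
  rational (circle_param (ratr q : R)).1 /\ rational (circle_param (ratr q : R)).2.
Proof.
split; [exists ((1 - q ^+ 2) / (1 + q ^+ 2)) => //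
      |exists (2 * q / (1 + q ^+ 2)) => //].
- by rewrite fmorph_div rmorphB rmorphD rmorphXn rmorph1.
- by rewrite fmorph_div rmorphM rmorph_nat rmorphD rmorphXn rmorph1.
Qed.

(** The net is finite so that one integer can clear all denominators. Equally spaced parameters
    cover the right half circle, and the sign [sg] the left one. *)
Lemma rational_circle_net (R : realType) (e : R) : 0 < e ->
  exists (J : finType) (z : J -> R * R),
    (forall j, [/\ rational (z j).1, rational (z j).2 &
                   (z j).1 ^+ 2 + (z j).2 ^+ 2 = 1]) /\
    forall x y, x ^+ 2 + y ^+ 2 = 1 ->
      exists j, (x - (z j).1) ^+ 2 + (y - (z j).2) ^+ 2 <= e.
Proof.
(* Parameters within [1 / M] give squared distance at most [4 / M^2 <= 4 / M <= e]. *)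
move=> e0; pose M := (Num.truncn (4 / e)).+1.
have M0 : 0 < M%:R :> R by rewrite ltr0n.
have Me : 4 / M%:R <= e.
  by rewrite ler_pdivrMr// mulrC -ler_pdivrMr// ltW// truncnS_gt.
pose s (m : 'I_(2 * M).+1) : rat := (m%:R - M%:R) / M%:R.
pose sg (b : bool) : R := (-1) ^+ b.
have sg2 b p1 p2 : (sg b * p1) ^+ 2 + (sg b * p2) ^+ 2 = p1 ^+ 2 + p2 ^+ 2.
  by rewrite !exprMn sqrr_sign !mul1r.
pose z (mb : 'I_(2 * M).+1 * bool) : R * R :=
  (sg mb.2 * (circle_param (ratr (s mb.1))).1,
   sg mb.2 * (circle_param (ratr (s mb.1))).2).
exists ('I_(2 * M).+1 * bool)%type, z; split=> [[m b]|x y xy].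
  have [[p _ pE] [q _ qE]] := rational_circle_param R (s m).
  split.
  - by exists ((-1) ^+ b * p) => //; rewrite rmorphMsign /= pE.
  - by exists ((-1) ^+ b * q) => //; rewrite rmorphMsign /= qE.
  - exact: etrans (sg2 _ _ _) (circle_param_unit _).
suff half x' y' : x' ^+ 2 + y' ^+ 2 = 1 -> 0 <= x' -> exists m,
    (x' - (circle_param (ratr (s m))).1) ^+ 2 +
    (y' - (circle_param (ratr (s m))).2) ^+ 2 <= e.
  have [x0|x0] := leP 0 x.
    have [m hm] := half _ _ xy x0; exists (m, false).
    by rewrite /z /sg !mul1r.
  have [||m hm] := half (- x) (- y); [by rewrite !sqrrN|lra|].
  exists (m, true); rewrite /z /sg /= expr1 !mulN1r !opprK.
  by move: hm; rewrite -!opprD !sqrrN.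
move=> {x y} {}xy x0.
have x1 : 0 < 1 + x' by lra.
set r := y' / (1 + x').
have r1 : -1 <= r by rewrite ler_pdivlMr//; nra.
have r2 : r <= 1 by rewrite ler_pdivrMr//; nra.
have p0 : 0 <= (r + 1) * M%:R by rewrite mulr_ge0//; lra.
have := truncn_itv p0; set m := Num.truncn _ => /andP[m1 m2].
have mM : (m < (2 * M).+1)%N.
  rewrite ltnS -(ler_nat R) natrM (le_trans m1)// ler_pM2r//; lra.
have [xE yE] : x' = (circle_param r).1 /\ y' = (circle_param r).2.
  by rewrite -(circle_param_half xy x0).
exists (Ordinal mM); rewrite xE yE.
apply: le_trans (circle_param_dist _ _) _; apply: le_trans Me.
have -> : ratr (s (Ordinal mM)) = (m%:R - M%:R) / M%:R :> R.
  by rewrite fmorph_div rmorphB !rmorph_nat.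
rewrite ler_pM2l//.
have -> : r - (m%:R - M%:R) / M%:R = ((r + 1) * M%:R - m%:R) / M%:R.
  by field; rewrite lt0r_neq0.
rewrite expr_div_n ler_pdivrMr ?exprn_gt0// expr2 mulKf ?lt0r_neq0//.
rewrite -natr1 in m2.
have M1 : 1 <= M%:R :> R by rewrite ler1n.
nra.
Qed.

(** * Descent in the integer lattice *)

Lemma common_denominator (R : realType) (I : finType) (f : I -> R) :
  (forall i, rational (f i)) ->
  exists2 D : nat, (0 < D)%N & forall i, exists a : int, D%:R * f i = a%:~R.
Proof.
move=> /(_ _)/cid2-/all_sig2[q _ qE].
exists (\prod_i `|denq (q i)|)%N.
  by apply: prodn_gt0 => i; rewrite absz_gt0 denq_neq0.
move=> i; rewrite (bigD1 i)//= natrM -(qE i).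
set r := (\prod_(j | _) _)%N.
have E : `|denq (q i)|%N%:R * ratr (q i) = (numq (q i))%:~R :> R.
  by rewrite pmulrn absz_denq -[RHS]ratr_int numqE rmorphM /= ratr_int mulrC.
by exists (numq (q i) * r%:Z); rewrite intrM -E -pmulrn mulrAC.
Qed.

Lemma finite_positive_bound (R : realFieldType) (I : finType) (f : I -> R) :
  (forall i, 0 < f i) -> exists2 e, 0 < e & forall i, e <= f i.
Proof.
move=> f0; exists (\big[Order.min/1]_i f i); last by move=> i; apply: bigmin_le.
by apply/bigmin_gtP; split.
Qed.

(** Half of the gap [2 * e] is reserved for the error of the rational net. *)
Lemma unit_separation_gap (R : rcfType) (I : finType) (u : I -> R * R) (v : R * R) :
  (forall i, 0 < v.1 * (u i).1 + v.2 * (u i).2) ->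
  exists w1 w2 e : R, [/\ w1 ^+ 2 + w2 ^+ 2 = 1, 0 < e &
    forall i, 2 * e <= w1 * (u i).1 + w2 * (u i).2].
Proof.
move=> hv; pose r := Num.sqrt (v.1 ^+ 2 + v.2 ^+ 2).
have r2 : r ^+ 2 = v.1 ^+ 2 + v.2 ^+ 2 by rewrite sqr_sqrtr ?addr_ge0 ?sqr_ge0.
have [r0|r0] := eqVneq r 0.
  (* [v] vanishes only if [I] is empty, and then any unit vector will do. *)
  exists 1, 0, 1; split=> [|//|i]; first by rewrite expr0n expr1n addr0.
  have [v1 v2] : v.1 = 0 /\ v.2 = 0.
    move/eqP: r2; rewrite r0 expr0n eq_sym paddr_eq0 ?sqr_ge0// !sqrf_eq0.
    by case/andP => /eqP-> /eqP->.
  by have := hv i; rewrite v1 v2 !mul0r addr0 ltxx.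
have r_gt0 : 0 < r by rewrite lt_neqAle eq_sym r0 sqrtr_ge0.
have [e e0 he] := finite_positive_bound hv.
exists (v.1 / r), (v.2 / r), (e / r / 2); split.
- by rewrite !expr_div_n -mulrDl -r2 divff// expf_neq0.
- by rewrite !divr_gt0.
- move=> i; have -> : 2 * (e / r / 2) = e / r by field.
  by rewrite !(mulrAC _ r^-1) -mulrDl ler_pM2r ?invr_gt0.
Qed.

(* [w'] is minus the quotient [w / v] of complex numbers of modulus 1, and the
   angle between [w' u] and [w] is the angle between [- u] and [v]. *)
Lemma rotated_against (R : realFieldType) (u1 u2 v1 v2 w1 w2 z1 z2 e : R) :
  u1 ^+ 2 + u2 ^+ 2 = 1 -> w1 ^+ 2 + w2 ^+ 2 = 1 -> 0 < e ->
  2 * e <= v1 * u1 + v2 * u2 ->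
  (- (w1 * v1 + w2 * v2) - z1) ^+ 2 + (w1 * v2 - w2 * v1 - z2) ^+ 2 <= e ^+ 2 ->
  (z1 * u1 - z2 * u2) * w1 + (z1 * u2 + z2 * u1) * w2 <= - e.
Proof.
move=> nu nw e0 huv.
set d1 := (X in X ^+ 2 + _); set d2 := (X in _ + X ^+ 2) => hd.
pose p1 := d1 * u1 - d2 * u2; pose p2 := d1 * u2 + d2 * u1.
have hp : p1 ^+ 2 + p2 ^+ 2 <= e ^+ 2.
  have -> : p1 ^+ 2 + p2 ^+ 2 = (d1 ^+ 2 + d2 ^+ 2) * (u1 ^+ 2 + u2 ^+ 2).
    by rewrite /p1 /p2; ring.
  by rewrite nu mulr1.
have hpw : (p1 * w1 + p2 * w2) ^+ 2 <= e ^+ 2.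
  have -> : (p1 * w1 + p2 * w2) ^+ 2 = (p1 ^+ 2 + p2 ^+ 2) * (w1 ^+ 2 + w2 ^+ 2)
      - (p1 * w2 - p2 * w1) ^+ 2 by ring.
  by rewrite nw mulr1; have := sqr_ge0 (p1 * w2 - p2 * w1); lra.
have hpe : - e <= p1 * w1 + p2 * w2.
  rewrite leNgt; apply/negP => h; nra.
have -> : (z1 * u1 - z2 * u2) * w1 + (z1 * u2 + z2 * u1) * w2 =
    - (v1 * u1 + v2 * u2) * (w1 ^+ 2 + w2 ^+ 2) - (p1 * w1 + p2 * w2).
  by rewrite /p1 /p2 /d1 /d2; ring.
rewrite nw mulr1; lra.
Qed.

Definition sqnorm (q : int * int) : nat := (`|q.1| ^ 2 + `|q.2| ^ 2)%N.

Lemma sqnormE (R : realDomainType) (q : int * int) :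
  (sqnorm q)%:R = q.1%:~R ^+ 2 + q.2%:~R ^+ 2 :> R.
Proof. by rewrite natrD !natrX !natr_absz !intr_norm !real_normK ?num_real. Qed.

Lemma lattice_descent (R : realType) (I : finType) (u : I -> R * R) (v : R * R) :
  (forall i, [/\ rational (u i).1, rational (u i).2 &
                 (u i).1 ^+ 2 + (u i).2 ^+ 2 = 1]) ->
  (forall i, 0 < v.1 * (u i).1 + v.2 * (u i).2) ->
  exists D K : nat, (0 < D)%N /\
    forall q : int * int, (K <= sqnorm q)%N ->
    exists (z : R * R) (X : I -> int * int), z.1 ^+ 2 + z.2 ^+ 2 = 1 /\
      forall i, [/\ (X i).1%:~R = D%:R * (z.1 * (u i).1 - z.2 * (u i).2),
                    (X i).2%:~R = D%:R * (z.1 * (u i).2 + z.2 * (u i).1) &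
                    (sqnorm (q + X i)%R < sqnorm q)%N].
Proof.
move=> hu /unit_separation_gap[v1 [v2 [e [nv e0 hv]]]].
have [J [z [hz hnet]]] := @rational_circle_net R (e ^+ 2) (exprn_gt0 2 e0).
pose f (jib : J * I * bool) : R := let: (j, i, b) := jib in
  if b then (z j).1 * (u i).1 - (z j).2 * (u i).2
  else (z j).1 * (u i).2 + (z j).2 * (u i).1.
have f_rat jib : rational (f jib).
  case: jib => [[j i] b]; rewrite /f.
  have [[a _ <-] [c _ <-] _] := hz j; have [[x _ <-] [y _ <-] _] := hu i.
  case: b; [exists (a * x - c * y) => //|exists (a * y + c * x) => //].
  - by rewrite rmorphB !rmorphM.
  - by rewrite rmorphD !rmorphM.
have [D D0 /(_ _)/cid-/all_sig[X XE]] := common_denominator f_rat.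
have D0R : 0 < D%:R :> R by rewrite ltr0n.
(* With [r] the length of [q], the squared norm changes by at most [D * (D - 2 * r * e)], which is
   negative for [r > D / (2 * e)]. *)
pose K := (Num.truncn ((D%:R / (2 * e)) ^+ 2)).+1.
exists D, K; split=> // q Kq; pose r : R := Num.sqrt (sqnorm q)%:R.
have r2 : r ^+ 2 = q.1%:~R ^+ 2 + q.2%:~R ^+ 2 by rewrite sqr_sqrtr// sqnormE.
have rD : D%:R / (2 * e) < r.
  rewrite -ltr_sqr ?nnegrE ?sqrtr_ge0 ?divr_ge0 ?mulr_ge0 ?(ltW e0)// sqr_sqrtr//.
  by apply: lt_le_trans (truncnS_gt _) _; rewrite ler_nat.
have r0 : 0 < r by apply: le_lt_trans rD; rewrite divr_ge0// mulr_ge0// ltW.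
rewrite ltr_pdivrMr ?mulr_gt0// in rD.
pose w1 := q.1%:~R / r; pose w2 := q.2%:~R / r.
have q1E : q.1%:~R = r * w1 by rewrite /w1 mulrC divfK ?lt0r_neq0.
have q2E : q.2%:~R = r * w2 by rewrite /w2 mulrC divfK ?lt0r_neq0.
have nw : w1 ^+ 2 + w2 ^+ 2 = 1.
  by rewrite /w1 /w2 !expr_div_n -mulrDl -r2 divff// expf_neq0 ?lt0r_neq0.
have [|j hj] := hnet (- (w1 * v1 + w2 * v2)) (w1 * v2 - w2 * v1).
  have -> : (- (w1 * v1 + w2 * v2)) ^+ 2 + (w1 * v2 - w2 * v1) ^+ 2 =
    (w1 ^+ 2 + w2 ^+ 2) * (v1 ^+ 2 + v2 ^+ 2) by ring.
  by rewrite nw nv mulr1.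
have [_ _ nz] := hz j.
exists (z j), (fun i => (X (j, i, true), X (j, i, false))); split=> // i.
have X1 := XE (j, i, true); have X2 := XE (j, i, false); rewrite /f in X1 X2.
split=> //; have [_ _ nu] := hu i.
have := rotated_against nu nw e0 (hv i) hj.
rewrite -(ltr_nat R) !sqnormE /= !intrD -X1 -X2 q1E q2E.
set a := _ - _; set b := _ + _ * (u i).1 => hab.
have ab1 : a ^+ 2 + b ^+ 2 = 1.
  have -> : a ^+ 2 + b ^+ 2 = ((z j).1 ^+ 2 + (z j).2 ^+ 2) *
    ((u i).1 ^+ 2 + (u i).2 ^+ 2) by rewrite /a /b; ring.
  by rewrite nz nu mulr1.
have -> : (r * w1 + D%:R * a) ^+ 2 + (r * w2 + D%:R * b) ^+ 2 =
    (r * w1) ^+ 2 + (r * w2) ^+ 2 +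
    D%:R * (2 * r * (a * w1 + b * w2) + D%:R * (a ^+ 2 + b ^+ 2)) by ring.
rewrite ab1 mulr1 gtrDl pmulr_rlt0//.
have : r * (a * w1 + b * w2) <= r * - e by rewrite ler_pM2l.
lra.
Qed.

(** * Plane coordinates and smiling copies *)

Section PlaneCoordinates.
Context {R : realType}.
Local Notation plane := 'rV[R]_2.

Definition vec (a b : R) : plane := \row_j (if j == ord0 then a else b).

(** Complex multiplication by [z], a rotation when [z] has modulus 1. *)
Definition rot (z : R * R) (x : plane) : plane :=
  vec (z.1 * x ord0 ord0 - z.2 * x ord0 ord_max)
      (z.1 * x ord0 ord_max + z.2 * x ord0 ord0).

Definition lattice_point (s : R) (q : int * int) : plane :=
  s *: vec q.1%:~R q.2%:~R.

Lemma plane_eq (x y : plane) :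
  x ord0 ord0 = y ord0 ord0 -> x ord0 ord_max = y ord0 ord_max -> x = y.
Proof.
move=> e0 e1; apply/rowP => j.
have [->//|->//] : j = ord0 \/ j = ord_max.
by case: j => -[|[|//]] h; [left|right]; apply: val_inj.
Qed.

Lemma eucl_distE (x y : plane) : eucl_dist x y =
  Num.sqrt ((x ord0 ord0 - y ord0 ord0) ^+ 2 +
            (x ord0 ord_max - y ord0 ord_max) ^+ 2).
Proof.
rewrite /eucl_dist !big_ord_recl big_ord0 addr0.
by rewrite (_ : lift ord0 ord0 = ord_max)//; apply: val_inj.
Qed.

Lemma eucl_dist1 (x y : plane) : eucl_dist x y = 1 <->
  (x ord0 ord0 - y ord0 ord0) ^+ 2 + (x ord0 ord_max - y ord0 ord_max) ^+ 2 = 1.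
Proof.
rewrite eucl_distE; set s := _ + _; have s0 : 0 <= s by rewrite addr_ge0 ?sqr_ge0.
by split=> [h|->]; rewrite ?sqrtr1// -(sqr_sqrtr s0) h expr1n.
Qed.

Lemma lattice_pointD s (p q : int * int) :
  lattice_point s (p + q) = lattice_point s p + lattice_point s q.
Proof. by apply: plane_eq; rewrite !mxE /= rmorphD mulrDr. Qed.

Lemma lattice_pointMn s (q : int * int) t :
  lattice_point s (q *+ t) = lattice_point (s * t%:R) q.
Proof.
elim: t => [|t IH]; last first.
  by rewrite mulrSr lattice_pointD IH -natr1 mulrDr mulr1 /lattice_point scalerDl.
rewrite mulr0n mulr0 /lattice_point scale0r.
by apply: plane_eq; rewrite !mxE /= mulr0.
Qed.

Lemma convex_set_combination (A : set plane) (a b : plane) (s t : R) :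
  convex_set A -> A a -> A b -> 0 < s -> 0 <= t ->
  A ((s + t)^-1 *: (s *: a + t *: b)).
Proof.
move=> cA Aa Ab s0 t0; have st0 : 0 < s + t by lra.
have l0 : 0 <= s / (s + t) by rewrite divr_ge0 ?ltW.
have l1 : s / (s + t) <= 1 by rewrite ler_pdivrMr// mul1r lerDl.
have := cA a b (Itv01 l0 l1) (mem_set Aa) (mem_set Ab).
move/set_mem; congr A.
rewrite /conv /= scalerDr !scalerA mulrC; congr (_ + _ *: _).
by rewrite -[LHS]/(1 - (s + t)^-1 * s); field; rewrite lt0r_neq0.
Qed.

(* A copy of the centres scaled by [t] is as good as a congruent one: the unit
   vector [(h, s)] with [t = 2 h] is at distance 1 from [t], so turning the
   centres by it puts the scaled ones on the circles. *)
Lemma smiling_of_similar (k n : nat) (phi : plane -> 'I_k) (O : plane)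
    (C : 'I_n -> set plane) (centre : 'I_n -> plane) (p : plane) (t : R)
    (z : R * R) (c : 'I_k) :
  (forall i, C i = unit_circle (centre i)) ->
  (forall i, eucl_dist (centre i) O = 1) ->
  -2 <= t <= 2 -> z.1 ^+ 2 + z.2 ^+ 2 = 1 ->
  (forall i, phi (p + t *: rot z (centre i - O)) = c) -> phi p <> c ->
  exists2 g : plane -> plane,
    plane_isometry g & smiling phi (g O) (image_family g C).
Proof.
move=> hC hO ht nz hc hp.
pose h := t / 2; pose s := Num.sqrt (1 - h ^+ 2).
have ns : h ^+ 2 + s ^+ 2 = 1.
  have h0 : 0 <= 1 - h ^+ 2.
    have -> : 1 - h ^+ 2 = (1 - h) * (1 + h) by ring.
    by rewrite mulr_ge0// /h; lra.
  by rewrite sqr_sqrtr// addrC subrK.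
pose g x : plane := p + rot (h, s) (rot z (x - O)).
exists g.
  move=> x y; rewrite !eucl_distE; congr Num.sqrt; rewrite !mxE /=.
  set a := x _ _; set b := x _ _; set a' := y _ _; set b' := y _ _.
  transitivity ((h ^+ 2 + s ^+ 2) * (z.1 ^+ 2 + z.2 ^+ 2) *
     ((a - a') ^+ 2 + (b - b') ^+ 2)); first by ring.
  by rewrite ns nz !mul1r.
have gO : g O = p by rewrite /g; apply: plane_eq; rewrite !mxE /=; ring.
exists c; split; last by rewrite gO.
move=> i; exists (p + t *: rot z (centre i - O)) => //.
have /eucl_dist1 := hO i.
set a := centre i _ _; set b := centre i _ _; set a' := O _ _; set b' := O _ _ => nO.
(* As [(h, - s)] is conjugate to [(h, s)], this is the preimage under [g]; its squared distance to
   the centre is [1 + t(t - 2h) = 1]. *)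
exists (O + t *: rot (h, - s) (centre i - O)).
  rewrite hC; apply/eucl_dist1; rewrite !mxE /= -/a -/b -/a' -/b' /=.
  transitivity (((a - a') ^+ 2 + (b - b') ^+ 2) *
    ((1 - t * h) ^+ 2 + (t * s) ^+ 2)); first by ring.
  have -> : (1 - t * h) ^+ 2 + (t * s) ^+ 2 =
    1 + t * (t * (h ^+ 2 + s ^+ 2) - 2 * h) by ring.
  by rewrite nO ns mul1r mulr1 /h; field.
have -> : p + t *: rot z (centre i - O) =
    p + (h ^+ 2 + s ^+ 2) *: (t *: rot z (centre i - O)) by rewrite ns scale1r.
by rewrite /g; apply: plane_eq; rewrite !mxE /=; ring.
Qed.

End PlaneCoordinates.

(** * Spreading the colour of a disc over the lattice *)

Definition grid (K : nat) : seq (int * int) :=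
  let s := [seq i%:Z - K%:Z | i <- iota 0 (2 * K).+1] in
  [seq (a, b) | a <- s, b <- s].

Lemma mem_grid (K : nat) (q : int * int) : (sqnorm q <= K)%N -> q \in grid K.
Proof.
case: q => a b; rewrite /sqnorm /= => hK.
have mem (x : int) : (`|x| ^ 2 <= K)%N ->
    x \in [seq i%:Z - K%:Z | i <- iota 0 (2 * K).+1].
  move=> hx; have hx' : (`|x| <= K)%N by move: hx; rewrite expnS expn1; nia.
  apply/mapP; exists (absz (x + K%:Z)); last by lia.
  by rewrite mem_iota; lia.
apply/allpairsP; exists (a, b); split=> //; apply: mem; apply: leq_trans hK.
- exact: leq_addr.
- exact: leq_addl.
Qed.

Theorem theorem1p2 (R : realType) (n : nat) (O : 'rV[R]_2)
    (C : 'I_n -> set 'rV[R]_2) (centre : 'I_n -> 'rV[R]_2)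
    (hC : bouquet O C)
    (hcentre : forall i, C i = unit_circle (centre i))
    (hO : rational_point O)
    (hOi : forall i, rational_point (centre i))
    (hext : ~ convex_hull (range centre) O) :
  forall (k : nat) (phi : 'rV[R]_2 -> 'I_k), proper_colouring phi ->
    exists2 g : 'rV[R]_2 -> 'rV[R]_2,
      plane_isometry g & smiling phi (g O) (image_family g C).
Proof.
move=> k phi hphi; apply: contrapT => nosmile.
have dO i : eucl_dist (centre i) O = 1.
  by have [_] := hC i; rewrite hcentre.
pose u (i : 'I_n) : R * R := (centre i ord0 ord0 - O ord0 ord0,
                  centre i ord0 ord_max - O ord0 ord_max).
have nu i : (u i).1 ^+ 2 + (u i).2 ^+ 2 = 1 by apply/eucl_dist1.
have [[v hv]|[i [j [l [x [y [x0 y0 e1 e2]]]]]]] := unit_separation nu; last first.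
  (* The combination reads [(1 + x + y) O = O_l + x O_i + y O_j], so [O] lies in every convex set
     containing the centres. *)
  apply: hext => A [cA hA].
  have mem m : A (centre m) by apply: hA; exists m.
  have Aij := convex_set_combination cA (mem l) (mem i) ltr01 x0.
  have x1 : 0 < 1 + x by lra.
  have := convex_set_combination cA Aij (mem j) x1 y0.
  congr A; rewrite /= in e1 e2.
  have x1n : 1 + x != 0 by apply: lt0r_neq0.
  have xy1 : 1 + x + y != 0 by apply: lt0r_neq0; lra.
  apply: (scalerI xy1); rewrite !scalerA !divff// !scale1r.
  apply: plane_eq; rewrite !mxE; lra.
have urat i : [/\ rational (u i).1, rational (u i).2 &
                  (u i).1 ^+ 2 + (u i).2 ^+ 2 = 1].
  split=> //.
  - have [a _ aE] := hOi i ord0; have [b _ bE] := hO ord0.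
    by exists (a - b) => //; rewrite rmorphB /= aE bE.
  - have [a _ aE] := hOi i ord_max; have [b _ bE] := hO ord_max.
    by exists (a - b) => //; rewrite rmorphB /= aE bE.
have [D [K [D0 hD]]] := lattice_descent urat hv.
have [N hN] := gallai (grid K) 'I_k.
(* With spacing [1 / (D N!)] and [N! = m t], the copy found has ratio [t / (D N!) = 1 / (D m)]. *)
have [p [t [t0 tN mono]]] :=
  hN (fun q => phi (lattice_point (D * N`!)%:R^-1 q)).
have /dvdnP[m Nm] : (t %| N`!)%N by rewrite dvdn_fact// t0.
have m0 : (0 < m)%N by have := fact_gt0 N; rewrite Nm; case: (m).
have tR : t%:R != 0 :> R by rewrite pnatr_eq0 -lt0n.
have mR : m%:R != 0 :> R by rewrite pnatr_eq0 -lt0n.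
have DR : D%:R != 0 :> R by rewrite pnatr_eq0 -lt0n.
pose chi q :=
  phi (lattice_point (D * N`!)%:R^-1 p + lattice_point (D * m)%:R^-1 q).
have {}mono q : q \in grid K -> chi q = chi 0.
  have K0 : (0 : int * int) \in grid K by apply: mem_grid.
  move=> qK; have := mono q 0 qK K0.
  rewrite !lattice_pointD !lattice_pointMn (_ : _ * t%:R = (D * m)%:R^-1) //.
  by rewrite Nm !natrM; field; rewrite tR mR DR.
have chi_const q : chi q = chi 0.
  have [b] := ubnP (sqnorm q); elim: b q => // b IH q; rewrite ltnS => qb.
  have [/mem_grid/mono//|/ltnW/hD[z [X [nz hX]]]] := leqP (sqnorm q) K.
  (* The shorter [q + X i] have colour [chi 0] by induction, and [X i / (D m)] is [u i] rotated by
     [z] and scaled by [1 / m]. *)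
  apply: contrapT => qc; apply: nosmile.
  apply: (smiling_of_similar (t := m%:R^-1) hcentre dO _ nz _ qc).
    have h0 : 0 <= (m%:R^-1 : R) by rewrite invr_ge0.
    have h1 : (m%:R^-1 : R) <= 1 by rewrite invf_le1 ?ltr0n// ler1n.
    by apply/andP; split; lra.
  move=> i; have [X1 X2 Xq] := hX i.
  rewrite -(IH (q + X i)) ?(leq_trans Xq)// /chi lattice_pointD addrA.
  congr (phi (_ + _)); apply: plane_eq; rewrite !mxE /= ?X1 ?X2 natrM /u /=;
    by field; rewrite mR DR.
(* At mesh [1 / (D m)] the lattice vector [(D m, 0)] is [(1, 0)]. *)
apply: (hphi _ _ _ (chi_const ((D * m)%:Z, 0))).
apply/eucl_dist1; rewrite !mxE /= natrM.
by field; rewrite mR DR pnatr_eq0 -lt0n fact_gt0.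
Qed.
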